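(* For every integer $n \ge 1$, the number of compositions of $n$ with parts restricted to $\{1,2\}$ is the $(n+1)$st Fibonacci number, i.e., $c_{12}(n) = F_{n+1}$.
   Context: The Fibonacci sequence is defined by $F_0 = 0$, $F_1 = 1$, and $F_n = F_{n-1}+F_{n-2}$ for $n \ge 2$. Given a positive integer $n$, a composition of $n$ is an ordered collection (finite sequence) of positive integers, called parts, whose sum is $n$; different orders count as different compositions. $C_{12}(n)$ denotes the set of compositions of $n$ all of whose parts belong to $\{1,2\}$, and $c_{12}(n) = |C_{12}(n)|$. *)

(* Defs.v *)
From mathcomp Require Import all_boot finmap.
From mathcomp Require Import mathcomp_extra boolp classical_sets functions cardinality.

Set Implicit Arguments.
Unset Strict Implicit.
Unset Printing Implicit Defensive.

Local Open Scope classical_set_scope.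

(* Normalised by F_0 = 0, F_1 = 1
   (unlike Zgcd_alt.fibonacci in Stdlib, which starts at 1, 1). *)
Fixpoint fib (n : nat) : nat :=
  match n with
  | 0 => 0
  | 1 => 1
  | (k.+1 as m).+1 => fib m + fib k
  end.

Definition compositions (n : nat) : set (seq nat) :=
  [set s | (forall p, p \in s -> 0 < p) /\ sumn s = n].

Definition C12 (n : nat) : set (seq nat) :=
  [set s | compositions n s /\ (forall p, p \in s -> p \in [:: 1; 2])].

Lemma finite_compositions (n : nat) : finite_set (compositions n).
Proof.
elim/ltn_ind: n => n IHn.
pose B := \bigcup_(m in `I_n) compositions m.
apply: (@sub_finite_set _ _
  ([set [::]] `|` [set p :: s | p in `I_n.+1 & s in B])).
  move=> [|p s] [s_gt0 /= def_n]; first by left.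
  have p_gt0 : 0 < p by apply: s_gt0; rewrite mem_head.
  right; exists p; first by rewrite /= ltnS -def_n leq_addr.
  exists s => //; exists (sumn s) => /=; first by rewrite -def_n -[ltnLHS]add0n ltn_add2r.
  by split=> // q sq; apply: s_gt0; rewrite inE sq orbT.
rewrite finite_setU; split; first exact: finite_set1.
apply: finite_image2; first exact: finite_II.
by apply: bigcup_finite; [exact: finite_II | move=> m /IHn].
Qed.

Lemma finite_C12 (n : nat) : finite_set (C12 n).
Proof. by apply: sub_finite_set (finite_compositions n) => s []. Qed.

(* [fset_set] is a default value on infinite sets; by [finite_C12] it is here
   the finite set with exactly the elements of [C12 n]. *)
Definition c12 (n : nat) : nat := #|` fset_set (C12 n) |.

(* Main.v *)
Require Import Defs.
From mathcomp Require Import all_boot.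
From mathcomp Require Import finmap classical_sets cardinality.

(** A composition of [n + 2] with parts in {1, 2} is its first part followed by
    an arbitrary composition of the same kind: of [n + 1] if the first part is
    1, of [n] if it is 2.  The two cases exclude each other, so the counts obey
    the Fibonacci recurrence ([c12_recurrence]).  They start with
    [c12 0 = 1 = fib 1] (the empty composition) and [c12 1 = 1 = fib 2], whence
    the shift of the index by one.  Starting at 0 rather than at 1 keeps both
    recursive calls inside the range of the induction. *)

Local Open Scope classical_set_scope.

Lemma C12_nil n : C12 n [::] <-> n = 0.
Proof. by split=> [[[_ <-]]|->]. Qed.

Lemma C12_cons n p s :
  C12 n (p :: s) <-> [/\ p \in [:: 1; 2], p <= n & C12 (n - p) s].
Proof.
split=> [[[s_gt0 /= <-] s12]|[p12 le_pn [[s_gt0 sum_s] s12]]].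
  split; [exact/s12/mem_head | exact: leq_addr |].
  by rewrite addKn; split; [split=> //|] => q sq;
    [apply: s_gt0 | apply: s12]; rewrite inE sq orbT.
split; first split=> [q|].
- by rewrite inE => /predU1P[->|/s_gt0//]; move: p12; rewrite !inE => /orP[]/eqP->.
- by rewrite /= sum_s subnKC.
- by move=> q; rewrite inE => /predU1P[->|/s12].
Qed.

Lemma C12_0 : C12 0 = [set [::]].
Proof.
apply/seteqP; split=> [[|p s] //|_ ->]; last exact/C12_nil.
by move=> /C12_cons[] + /[!leqn0] /eqP p0; rewrite p0.
Qed.

Lemma C12_1 : C12 1 = [set [:: 1]].
Proof.
apply/seteqP; split=> [[|p s]|_ ->]; first by move=> /C12_nil.
  move=> /C12_cons[]; rewrite !inE => /orP[]/eqP-> // _.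
  by rewrite subnn C12_0 => ->.
by apply/C12_cons; rewrite subnn C12_0.
Qed.

Lemma C12_recurrence n :
  C12 n.+2 = (cons 1 @` C12 n.+1) `|` (cons 2 @` C12 n).
Proof.
apply/seteqP; split=> [[|p s]|_ [] [s Cs <-]].
- by move=> /C12_nil.
- move=> /C12_cons[]; rewrite !inE => /orP[]/eqP-> _; rewrite ?subn1 ?subn2 => Cs.
    by left; exists s.
  by right; exists s.
- by apply/C12_cons; rewrite subn1.
- by apply/C12_cons; rewrite subn2.
Qed.

Lemma c12_recurrence n : c12 n.+2 = c12 n.+1 + c12 n.
Proof.
have fC p m : finite_set (cons p @` C12 m).
  exact/finite_image/finite_C12.
have card_cons p m : #|` fset_set (cons p @` C12 m)| = c12 m.
  rewrite fset_set_image; last exact: finite_C12.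
  by rewrite card_imfset // => s t [].
(* The first part tells the two images apart. *)
have dis : (cons 1 @` C12 n.+1) `&` (cons 2 @` C12 n) = set0.
  by apply/seteqP; split=> // _ [[s _ <-] [t _]].
rewrite {1}/c12 C12_recurrence fset_setU // cardfsU -fset_setI // dis.
by rewrite fset_set0 cardfs0 subn0 !card_cons.
Qed.

Lemma c12_fib n : c12 n = fib n.+1.
Proof.
elim/ltn_ind: n => -[|[|n]] IHn.
- by rewrite /c12 C12_0 fset_set1 cardfs1.
- by rewrite /c12 C12_1 fset_set1 cardfs1.
- by rewrite c12_recurrence !IHn.
Qed.

Theorem proposition1 : forall n : nat, 1 <= n -> c12 n = fib (n + 1).
Proof. by move=> n _; rewrite addn1 c12_fib. Qed.
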